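(* For every fixed $k\in\mathbb{N}$ and every $r=1,\dots,k$, $$\lim_{T\to\infty}\left[\int_{t\in(0,\overset{r-1}{T}]^+}\left\{\ln t-\left|\zeta\left(\tfrac12+it\right)\right|^2\right\}dt-\int_{t\in(0,\overset{r-1}{T}]^-}\left\{-\ln t+\left|\zeta\left(\tfrac12+it\right)\right|^2\right\}dt-\int_{\overset{r-1}{T}}^{\overset{r}{T}}\left|\zeta\left(\tfrac12+it\right)\right|^2dt-(\ln 2\pi-1-c)\,\overset{r-1}{T}\right]=-c_0 .$$
   Context: $\zeta$ is the Riemann zeta-function and $c$ is Euler's constant. Constant $c_0$: the Titchmarsh-Kober-Atkinson constant, i.e. the constant in the asymptotic formula $\int_0^\infty|\zeta(\frac12+it)|^2e^{-2\delta t}\,dt=\frac{c-\ln(4\pi\delta)}{2\sin\delta}+c_0+O(\delta)$ as $\delta\to0^+$. Jacob's ladder: let $\mu\in C^\infty([y_0,\infty))$ be a monotonically increasing, unbounded function with $\mu(y)\ge 7y\ln y$. For all sufficiently large $T$, let $\varphi(T)$ be the solution $x=x(T)$ of $\int_0^{\mu(x)}|\zeta(\frac12+it)|^2e^{-2t/x}\,dt=\int_0^T|\zeta(\frac12+it)|^2\,dt$, and put $\varphi_1(T)=\frac12\varphi(T)$. The function $\varphi_1$ (Jacob's ladder) is increasing and continuous for large $T$, tends to infinity, and satisfies $\int_0^T|\zeta(\frac12+it)|^2dt=\varphi_1(T)\ln\varphi_1(T)+(c-\ln2\pi)\varphi_1(T)+c_0+O(\frac{\ln T}{T})$. Reverse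 iterations: $\overset{0}{T}=T$ and $\overset{r}{T}=\varphi_1^{-1}(\overset{r-1}{T})$ for $r\ge1$, i.e. $\varphi_1(\overset{r}{T})=\overset{r-1}{T}$ ($T$ sufficiently large); one has $T<\overset{1}{T}<\overset{2}{T}<\cdots$ and $\overset{r}{T}\sim T$ as $T\to\infty$ for fixed $r$. Sets: $(0,U]^+=\{t: 0<t\le U,\ \ln t>|\zeta(\frac12+it)|^2\}$ and $(0,U]^-=\{t:0<t\le U,\ \ln t\le|\zeta(\frac12+it)|^2\}$. *)

(* Defs.v *)
From mathcomp Require Export all_boot all_order all_algebra.
From mathcomp Require Export all_classical all_reals all_analysis.
From mathcomp Require Export complex.
Export numFieldNormedType.Exports.
Export Order.TTheory GRing.Theory Num.Theory.

Set Implicit Arguments.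
Unset Strict Implicit.
Unset Printing Implicit Defensive.

Local Open Scope classical_set_scope.
Local Open Scope ring_scope.

(* n^(-s) = n^(-Re s) (cos (Im s ln n) - i sin (Im s ln n)), used for n >= 1 *)
Definition nat_cpowN (R : realType) (n : nat) (s : R[i]) : R[i] :=
  let r := expR (- (complex.Re s * ln n%:R)) in
  let th := complex.Im s * ln n%:R in
  Complex (r * cos th) (- (r * sin th)).

(* The Riemann zeta-function as the analytic continuation to C \ {1} of its
   Dirichlet series; this determines zeta at every s <> 1, and zeta 1 is
   unconstrained. The topology on R[i] is that of the modulus. *)
Definition is_riemann_zeta (R : realType) (zeta : R[i] -> R[i]) : Prop :=
  (forall s : R[i], 1 < complex.Re s ->
     (fun N : nat => \sum_(1 <= n < N.+1) nat_cpowN n s : R[i]^o) @ \oo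
       --> (zeta s : R[i]^o)) /\
  (forall s : R[i], s != 1 -> derivable (zeta : R[i]^o -> R[i]^o) s 1).

(* |zeta(1/2 + it)|^2; Normc.normc is the real-valued complex modulus. *)
Definition zeta_sq (R : realType) (zeta : R[i] -> R[i]) (t : R) : R :=
  ComplexField.Normc.normc (zeta (Complex 2^-1 t)) ^+ 2.

Definition euler_const (R : realType) : R :=
  limn (fun n : nat => series harmonic n - ln n%:R : R).

(* The integral from a to b, with the usual orientation: it changes sign when
   the bounds are exchanged. *)
Definition integral_from_to (R : realType) (a b : R) (f : R -> R) : R :=
  if a <= b then \int[lebesgue_measure]_(t in `[a, b]) f t
  else - \int[lebesgue_measure]_(t in `[b, a]) f t.

(* The Titchmarsh-Kober-Atkinson constant: the constant term c0 of the asymptotic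
   formula below, which determines it uniquely. The real-valued integral is 0 if
   the integrand is not integrable, but the formula rules this out for small
   delta, because its main term tends to +oo. *)
Definition is_TKA_const (R : realType) (zeta : R[i] -> R[i]) (c0 : R) : Prop :=
  (fun delta : R =>
     \int[lebesgue_measure]_(t in `[0, +oo[)
        (zeta_sq zeta t * expR (- (2 * delta * t)))
     - ((euler_const R - ln (4 * pi * delta)) / (2 * sin delta) + c0))
  =O_ ((0 : R)^'+) (fun delta : R => delta).

(* f is C^oo on [a, +oo[, all derivatives (d n is the n-th one) being taken
   relatively to [a, +oo[, hence one-sided at a. *)
Definition smooth_from (R : realType) (a : R) (f : R -> R) : Prop :=
  exists d : nat -> R -> R,
    (forall x, a <= x -> d 0%N x = f x) /\
    (forall (n : nat) (x : R), a <= x ->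
       (d n y - d n x) / (y - x) @[y --> within `[a, +oo[ x^'] --> d n.+1 x).

Record ladder_weight (R : realType) (y0 : R) (mu : R -> R) : Prop := {
  ladder_weight_pos : 0 < y0;
  ladder_weight_smooth : smooth_from y0 mu;
  ladder_weight_mono : forall x y, y0 <= x -> x <= y -> mu x <= mu y;
  ladder_weight_unbounded : forall M, exists2 y, y0 <= y & M < mu y;
  ladder_weight_ge : forall y, y0 <= y -> 7 * y * ln y <= mu y }.

(* For T >= T0, x = phi T is a solution, in the domain [y0, +oo[ of mu, of
   the equation defining the ladder. *)
Definition is_ladder_solution (R : realType) (zeta : R[i] -> R[i])
    (y0 : R) (mu : R -> R) (T0 : R) (phi : R -> R) : Prop :=
  forall T, T0 <= T ->
    y0 <= phi T /\
    integral_from_to 0 (mu (phi T))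
      (fun t => zeta_sq zeta t * expR (- (2 * t / phi T)))
    = integral_from_to 0 T (zeta_sq zeta).

Definition jacob_ladder (R : realType) (phi : R -> R) (T : R) : R := phi T / 2.

(* psi is the inverse of phi1 : [T0, +oo[ -> R at all large arguments. Since phi1
   is only specified on [T0, +oo[, psi is required to take its values there. *)
Definition is_ladder_inverse (R : realType) (T0 : R) (phi1 psi : R -> R) : Prop :=
  \forall U \near +oo, T0 <= psi U /\ phi1 (psi U) = U.

Definition reverse_iterate (R : realType) (psi : R -> R) (r : nat) (T : R) : R :=
  iter r psi T.

Definition set_plus (R : realType) (zeta : R[i] -> R[i]) (U : R) : set R :=
  [set t | 0 < t <= U /\ zeta_sq zeta t < ln t].

Definition set_minus (R : realType) (zeta : R[i] -> R[i]) (U : R) : set R :=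
  [set t | 0 < t <= U /\ ln t <= zeta_sq zeta t].

(* Main.v *)
Require Import Defs.
From mathcomp Require Import measurable_realfun ring lra.

(** Write Z(t) for the squared modulus of zeta on the critical line and I(T) for
its integral over [0, T]. The two set integrals recombine into the integral
over ]0, U] of ln t - Z(t), which is U ln U - U - I(U); subtracting the integral
of Z from U to V leaves U ln U - U - I(V). So everything rests on the value of I
at V, the preimage of U under the ladder.

By the equation defining the ladder, I(V) is the integral of Z(t) exp(-2t/x)
over [0, mu x] at x = 2U. The same integral over the whole half-line, J(x), is
what the Titchmarsh-Kober-Atkinson formula describes at delta = 1/x:
J(x) = (x/2) (c - ln (4 pi) + ln x) + c0 + o(1),
once 1 / (2 sin (1/x)) has been replaced by x/2 ([inv_sin_main_term],
[laplace_zeta_sq_asymp]). Cutting the integral at mu x costs at most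
exp(- mu x / x) J(2x) ([laplace_tail]), and since mu x >= 7 x ln x and J grows
slower than a square, this tends to 0 ([truncated_laplace_asymp]). At x = 2U,
I(V) = U ln U + (c - ln (2 pi)) U + c0 + o(1),
and the terms in U ln U and U cancel, leaving - c0
([first_reverse_iterate_limit]).

The passage from r = 1 to any r only requires that the iterates of the inverse
ladder tend to infinity. This follows from the same formula: I(V) tends to
infinity with U, and I is nondecreasing, so V cannot stay bounded
([cvg_ladder_inverse]).

Zeta itself enters through the Titchmarsh-Kober-Atkinson formula and through its
continuity on the critical line, which makes Z locally integrable. *)

Set Implicit Arguments.
Unset Strict Implicit.
Unset Printing Implicit Defensive.

Local Open Scope classical_set_scope.
Local Open Scope ring_scope.

(** * Continuity of zeta on the critical line *)

Lemma cvg_vertical_line (R : realType) (a t : R) :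
  (fun u : R => Complex a u : R[i]^o) @ t --> (Complex a t : R[i]^o).
Proof.
apply/cvgrPdist_lt => e e0.
have [e1 e10 ->] : exists2 e1 : R, 0 < e1 & e = e1%:C%C.
  case: e e0 => r i; rewrite ltcE /= => /andP[/eqP -> r0]; by exists r.
near=> u; rewrite normc_def /= subrr expr0n add0r sqrtr_sqr ltcR.
near: u; exact: cvgr_dist_lt.
Unshelve. all: by end_near. Qed.

Lemma cvg_normc (R : realType) (T : Type) (F : set_system T) (f : T -> R[i])
    (z : R[i]) :
  Filter F ->
  (f : T -> R[i]^o) @ F --> (z : R[i]^o) ->
  ComplexField.Normc.normc (f x) @[x --> F] --> ComplexField.Normc.normc z.
Proof.
move=> FF fz; apply/cvgrPdist_lt => e e0.
have h : \forall x \near F, `|z - f x| < e%:C%C.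
  by move/cvgrPdist_lt: fz; apply; rewrite ltcR.
near=> x; rewrite -ltcR.
have : `|z - f x| < e%:C%C by near: x.
apply: le_lt_trans.
have := lerB_dist z (f x); have := lerB_dist (f x) z.
rewrite (distrC (f x)) !normc_def -!rmorphB /= !lecR => h1 h2.
have nE (w : R[i]) : ComplexField.Normc.normc w =
    Num.sqrt (complex.Re w ^+ 2 + complex.Im w ^+ 2) by case: w.
by rewrite !nE ler_norml lerNl opprB; apply/andP.
Unshelve. all: by end_near. Qed.

Lemma continuous_zeta_sq (R : realType) (zeta : R[i] -> R[i]) :
  is_riemann_zeta zeta -> continuous (zeta_sq zeta).
Proof.
move=> [_ dzeta] t.
have ne1 : Complex 2^-1 t != 1 :> R[i].
  by rewrite eq_complex /=; apply/negP => /andP[/eqP]; lra.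
have czeta : {for (Complex 2^-1 t : R[i]^o),
    continuous (zeta : R[i]^o -> R[i]^o)}.
  exact/differentiable_continuous/derivable1_diffP/dzeta.
apply: cvgM; apply: cvg_normc;
  exact: continuous_comp (@cvg_vertical_line _ _ t) czeta.
Qed.

Lemma zeta_sq_ge0 (R : realType) (zeta : R[i] -> R[i]) (t : R) :
  0 <= zeta_sq zeta t.
Proof. exact: sqr_ge0. Qed.

(** * The integral of the logarithm from 0 *)

Lemma ln_le_sqrt (R : realType) (x : R) : 0 < x -> ln x <= 2 * Num.sqrt x.
Proof.
move=> x0; have s0 : 0 < Num.sqrt x by rewrite sqrtr_gt0.
have := ln_sublinear s0; rewrite -{3}(sqr_sqrtr (ltW x0)) lnXn //; lra.
Qed.

Lemma cvg_ln_div (R : realType) :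
  ln x / x @[x --> (+oo : set_system R)] --> (0 : R).
Proof.
apply/cvgr0Pnorm_le => e e0; near=> x.
have x1 : 1 <= x by near: x; apply: nbhs_pinfty_ge; rewrite num_real.
have x0 : 0 < x by lra.
have xe : (2 / e) ^+ 2 <= x by near: x; apply: nbhs_pinfty_ge; rewrite num_real.
have s0 : 0 < Num.sqrt x by rewrite sqrtr_gt0.
have se : 2 / e <= Num.sqrt x.
  have : Num.sqrt ((2 / e) ^+ 2) <= Num.sqrt x by rewrite ler_sqrt ?(ltW x0).
  rewrite sqrtr_sqr ger0_norm //.
  by rewrite divr_ge0 // ltW.
rewrite ger0_norm ?divr_ge0 ?ln_ge0 ?(ltW x0) //.
rewrite ler_pdivrMr // (le_trans (ln_le_sqrt x0)) //.
have {2}-> : x = Num.sqrt x * Num.sqrt x by rewrite -expr2 sqr_sqrtr ?(ltW x0).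
by rewrite mulrA ler_pM2r // mulrC -ler_pdivrMr.
Unshelve. all: by end_near. Qed.

Lemma is_derive_xlnx_subx (R : realType) (x : R) : 0 < x ->
  is_derive x 1 (fun y : R => y * ln y - y) (ln x).
Proof.
move=> x0. have h := is_derive1_ln x0.
apply: is_derive_eq. by rewrite /GRing.scale /= !mulr1 divff ?gt_eqF// ; lra.
Qed.

Lemma Rintegral_ln_itvcc (R : realType) (a b : R) : 0 < a -> a < b ->
  lebesgue_measure.-integrable `[a, b] (EFin \o @ln R) /\
  \int[lebesgue_measure]_(t in `[a, b]) ln t = (b * ln b - b) - (a * ln a - a).
Proof.
move=> a0 ab.
have cl : {within `[a, b], continuous (@ln R)}.
  apply: continuous_in_subspaceT => x /set_mem/=.
  rewrite in_itv/= => /andP[ax _].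
  by apply: continuous_ln; apply: lt_le_trans ax.
split.
  by apply: continuous_compact_integrable => //; exact: segment_compact.
have d x : a <= x -> is_derive x 1 (fun y : R => y * ln y - y) (ln x).
  by move=> ax; apply: is_derive_xlnx_subx; lra.
have c x : a <= x -> {for x, continuous (fun y : R => y * ln y - y)}.
  by move=> /d h; apply/differentiable_continuous/derivable1_diffP/ex_derive.
rewrite /Rintegral.
rewrite (continuous_FTC2 ab cl (F := (fun y : R => y * ln y - y))) //.
- split.
  + by move=> x; rewrite in_itv /= => /andP[ax _]; have := d _ (ltW ax); case.
  + by apply: cvg_at_right_filter; apply: c.
  + by apply: cvg_at_left_filter; apply: c; exact: ltW.
- move=> x; rewrite in_itv /= => /andP[ax _]; rewrite derive1E.
  by have h := d _ (ltW ax); rewrite derive_val.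
Qed.

(** The logarithm is unbounded at 0, out of reach of the fundamental theorem on
a closed interval; as it has constant sign on ]0, 1], monotone convergence along
the intervals [1/(n+1), 1] applies. *)
Lemma integral_ln_itvoc01 (R : realType) :
  (\int[lebesgue_measure]_(t in `]0%R, 1%R]) (@ln R t)%:E = (-1)%:E)%E.
Proof.
pose F n : set R := `[n.+1%:R^-1, 1]%classic.
have UF : \bigcup_n F n = `]0, 1]%classic.
  apply/seteqP; split => x /=; rewrite in_itv /=.
    move=> [n _]; rewrite /F /= in_itv /= => /andP[nx ->]; rewrite andbT.
    by apply: lt_le_trans nx; rewrite invr_gt0.
  move=> /andP[x0 x1]; exists (Num.truncn x^-1) => //.
  rewrite /F /= in_itv /= x1 andbT.
  rewrite -[leRHS]invrK lef_pV2 ?posrE ?invr_gt0 //.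
  by apply/ltW/truncnS_gt.
have FE n : (\int[lebesgue_measure]_(t in F n) (@ln R t)%:E)%E =
   (-1 + (n.+1%:R^-1 + ln (n.+1%:R) / n.+1%:R))%:E.
  case: n => [|n].
    rewrite /F invr1 set_itv1 integral_set1 ln1 mul0r addr0; by rewrite addNr.
  have a0 : 0 < n.+2%:R^-1 :> R by rewrite invr_gt0.
  have a1 : n.+2%:R^-1 < 1 :> R by rewrite invf_lt1 // ltr1n.
  have [fi] := Rintegral_ln_itvcc a0 a1.
  rewrite /Rintegral => e.
  rewrite -[LHS]fineK ?integrable_fin_num //; last exact: measurable_itv.
  by rewrite [fine _]e ln1 lnV ?posrE //; congr (_%:E); ring.
have cF : ((\int[lebesgue_measure]_(t in F n) (@ln R t)%:E) @[n --> \oo]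
    --> (-1)%:E)%E.
  rewrite (eq_cvg _ _ FE).
  apply: cvg_EFin; first by near=> n.
  rewrite -[X in _ --> X]addr0; apply: cvgD; first exact: cvg_cst.
  rewrite -[X in _ --> X]addr0; apply: cvgD; first exact: cvg_harmonic.
  have h : (n.+1%:R : R) @[n --> \oo] --> +oo.
    by rewrite (cvg_shiftS (fun n => n%:R : R)); exact: cvgr_idn.
  exact: cvg_comp h (@cvg_ln_div R).
rewrite -UF; apply: cvg_unique cF => //.
apply: le0_nondecreasing_set_cvg_integral.
- apply/nondecreasing_seqP => n; rewrite subsetEset; apply: subset_itvr.
  by rewrite bnd_simp lef_pV2 ?posrE // ler_nat.
- by move=> i; exact: measurable_itv.
- move=> i; apply/measurable_EFinP; apply: measurable_funTS.
  exact: measurable_ln.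
- by move=> i x; rewrite /F /= in_itv /= => /andP[_ x1]; rewrite lee_fin ln_le0.
Unshelve. all: by end_near. Qed.

Lemma Rintegral_ln (R : realType) (U : R) : 1 <= U ->
  lebesgue_measure.-integrable `]0, U] (EFin \o @ln R) /\
  \int[lebesgue_measure]_(t in `]0, U]) ln t = U * ln U - U.
Proof.
have I01 : lebesgue_measure.-integrable `]0, 1%R] (EFin \o @ln R).
  apply/integrableP; split.
    apply/measurable_EFinP; apply: measurable_funTS; exact: measurable_ln.
  rewrite (@eq_integral _ _ _ lebesgue_measure _
    (fun x : R => (- (ln x)%:E)%E)); last first.
    move=> x /set_mem /=; rewrite in_itv /= => /andP[_ x1].
    by rewrite ler0_norm ?ln_le0.
  rewrite integralN; last first.
    apply: fin_num_adde_defr; rewrite integral0_eq // => x x01.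
    rewrite (@le0_funeposE _ _ `]0, 1%R]%classic) ?inE // => y /=.
    by rewrite in_itv /= => /andP[_ y1]; rewrite lee_fin ln_le0.
  by rewrite integral_ln_itvoc01 ltry.
rewrite le_eqVlt => /predU1P[<-|U1].
  by split => //; rewrite /Rintegral integral_ln_itvoc01 /= ln1 mulr0 add0r.
have [I1U R1U] := Rintegral_ln_itvcc (@ltr01 R) U1.
have E : `]0, U]%classic = `]0, 1] `|` `]1, U] :> set R.
  by apply: itv_bndbnd_setU; rewrite bnd_simp // ltW.
have dj : [disjoint `]0%R, 1%R]%classic & `]1%R, U]%classic].
  apply/disj_setPS => x /= []; rewrite !in_itv /= => /andP[_ x1] /andP[].
  by rewrite ltNge x1.
have I1U' : lebesgue_measure.-integrable `]1, U] (EFin \o @ln R).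
  by apply: integrableS I1U => //; apply: subset_itvr; rewrite bnd_simp.
have IU : lebesgue_measure.-integrable (`]0, 1] `|` `]1, U]) (EFin \o @ln R).
  have ml : measurable_fun (`]0, 1] `|` `]1, U]) (EFin \o @ln R).
    apply/measurable_EFinP; apply: measurable_funTS; exact: measurable_ln.
  apply/integrableP; split => //.
  rewrite ge0_integral_setU //=; last first.
    apply/measurable_EFinP; apply: measurableT_comp => //.
    exact/measurable_EFinP.
  by apply: lte_add_pinfty; [case/integrableP: I01|case/integrableP: I1U'].
rewrite E; split => //.
rewrite Rintegral_setU // [X in _ + X]Rintegral_itv_obnd_cbnd // R1U /Rintegral.
by rewrite integral_ln_itvoc01 /= ln1; ring.
Qed.

(** * The main term of the Titchmarsh-Kober-Atkinson formula *)

Lemma sin_le_id (R : realType) (x : R) : 0 <= x -> sin x <= x.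
Proof.
rewrite le_eqVlt => /predU1P[<-|x0]; first by rewrite sin0.
have [|c _] := @MVT R sin cos 0 x x0.
  by apply: continuous_subspaceT => y; exact: continuous_sin.
by rewrite sin0 !subr0 => ->; rewrite ler_piMl ?cos_le1 // ltW.
Qed.

Lemma cos_ge_1subsqr (R : realType) (x : R) : 0 <= x -> 1 - x ^+ 2 <= cos x.
Proof.
rewrite le_eqVlt => /predU1P[<-|x0]; first by rewrite cos0 expr0n subr0.
have [|c] := @MVT R cos (fun y => - sin y) 0 x x0.
  by apply: continuous_subspaceT => y; exact: continuous_cos.
rewrite in_itv /= cos0 subr0 => /andP[c0 cx] e.
have := sin_le_id (ltW c0) => sc.
have : sin c * x <= x * x by rewrite ler_pM2r // (le_trans sc) // ltW.
by rewrite expr2; move: e; lra.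
Qed.

(** The constants, here and for the cosine, are not sharp: only the cubic order of
the error matters below. *)
Lemma sin_ge_cubic (R : realType) (x : R) : 0 <= x -> x - x ^+ 3 <= sin x.
Proof.
rewrite le_eqVlt => /predU1P[<-|x0]; first by rewrite sin0 expr0n subr0.
have [|c] := @MVT R sin cos 0 x x0.
  by apply: continuous_subspaceT => y; exact: continuous_sin.
rewrite in_itv /= sin0 !subr0 => /andP[c0 cx] ->.
rewrite (_ : x - x ^+ 3 = (1 - x ^+ 2) * x); last by ring.
rewrite ler_pM2r // (le_trans _ (cos_ge_1subsqr (ltW c0))) //.
by rewrite lerD2l lerN2 ler_sqr ?nnegrE ?ltW.
Qed.

Lemma inv_sin_approx (R : realType) (x : R) : 0 < x <= 2^-1 ->
  `|(sin x)^-1 - x^-1| <= 2 * x.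
Proof.
move=> /andP[x0 x2].
have s1 := sin_le_id (ltW x0).
have s2 : x / 2 <= sin x by apply: le_trans (sin_ge_cubic (ltW x0)); nra.
have s3 := sin_ge_cubic (ltW x0).
have s0 : 0 < sin x by apply: lt_le_trans s2; lra.
have -> : (sin x)^-1 - x^-1 = (x - sin x) / (x * sin x).
  by field; rewrite !gt_eqF.
rewrite ger0_norm; last by rewrite divr_ge0 ?subr_ge0 // mulr_ge0 // ltW.
rewrite ler_pdivrMr ?mulr_gt0 //.
have := ler_wpM2l (sqr_ge0 x) s2; lra.
Qed.

Lemma cvg_cst_add_ln_div (R : realType) (K : R) :
  (K + ln x) / x @[x --> (+oo : set_system R)] --> (0 : R).
Proof.
rewrite -[X in _ --> X]addr0; under eq_cvg do rewrite mulrDl.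
apply: cvgD; last exact: cvg_ln_div.
rewrite -[X in _ --> X](mulr0 K); apply: cvgMr; apply/gtr0_cvgV0.
  by apply: nbhs_pinfty_gt; rewrite num_real.
exact: cvg_id.
Qed.

(** The error is (K + ln x) times O(1/x). A bound o(1) on the difference between
1 / sin (1/x) and x would not do, because of the factor ln x: this is why the
cubic term of the sine is needed. *)
Lemma inv_sin_main_term (R : realType) (K : R) :
  (K + ln x) / (2 * sin x^-1) - x / 2 * (K + ln x)
    @[x --> (+oo : set_system R)] --> (0 : R).
Proof.
apply/cvgr0Pnorm_le => e e0; near=> x.
have x2 : 2 <= x by near: x; apply: nbhs_pinfty_ge; rewrite num_real.
have hx : `|(K + ln x) / x| <= e.
  by near: x; move/cvgr0Pnorm_le: (cvg_cst_add_ln_div K); apply.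
apply: le_trans hx.
have xi : 0 < x^-1 <= 2^-1 by rewrite invr_gt0 lef_pV2 ?posrE //; lra.
have := inv_sin_approx xi; rewrite invrK => hs.
have -> : (K + ln x) / (2 * sin x^-1) - x / 2 * (K + ln x) =
    (K + ln x) * (((sin x^-1)^-1 - x) / 2).
  by rewrite invfM; ring.
rewrite normrM [leRHS]normrM ler_wpM2l // normrM.
have [xi0 _] := andP xi.
by rewrite (gtr0_norm xi0) (@gtr0_norm _ 2^-1) ?invr_gt0 //; lra.
Unshelve. all: by end_near. Qed.

(** * Integrals of nonnegative continuous functions *)

Lemma continuous_itv_integrable (R : realType) (f : R -> R) (a b : R) :
  continuous f -> lebesgue_measure.-integrable `[a, b] (EFin \o f).
Proof.
move=> cf; apply: continuous_compact_integrable; first exact: segment_compact.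
exact: continuous_subspaceT.
Qed.

Lemma integral_from_to_chasles (R : realType) (f : R -> R) (U V : R) :
  continuous f -> 0 <= U -> 0 <= V ->
  integral_from_to 0 U f + integral_from_to U V f = integral_from_to 0 V f.
Proof.
move=> cf; have key (a b : R) : 0 <= a -> a <= b ->
    \int[lebesgue_measure]_(t in `[0, a]) f t +
    \int[lebesgue_measure]_(t in `[a, b]) f t =
    \int[lebesgue_measure]_(t in `[0, b]) f t.
  move=> a0 ab; rewrite -[X in _ + X]Rintegral_itv_obnd_cbnd; last first.
    have := @continuous_itv_integrable _ _ a b cf; apply: integrableS => //.
    by apply: subset_itvr; rewrite bnd_simp.
  rewrite -(Rintegral_itvB (@continuous_itv_integrable _ _ 0 b cf)) ?bnd_simp //.
  by rewrite addrC subrK.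
move=> U0 V0; rewrite /integral_from_to U0 V0; case: ifPn => [UV|].
  exact: key.
by rewrite -ltNge => /ltW VU; rewrite -(key V U) // addrK.
Qed.

Lemma integral_from_to_ge0 (R : realType) (a b : R) (f : R -> R) :
  a <= b -> (forall t, 0 <= f t) -> 0 <= integral_from_to a b f.
Proof. by move=> ab f0; rewrite /integral_from_to ab; exact: Rintegral_ge0. Qed.

Lemma integral_from_to_le0 (R : realType) (a b : R) (f : R -> R) :
  b <= a -> (forall t, 0 <= f t) -> integral_from_to a b f <= 0.
Proof.
rewrite /integral_from_to le_eqVlt => /predU1P[->|ba] f0.
  by rewrite lexx set_itv1 Rintegral_set1.
by rewrite (lt_geF ba) oppr_le0; exact: Rintegral_ge0.
Qed.

Lemma le_integral_from_to0 (R : realType) (f : R -> R) (u v : R) :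
  continuous f -> (forall t, 0 <= f t) -> u <= v -> 0 <= v ->
  integral_from_to 0 u f <= integral_from_to 0 v f.
Proof.
move=> cf f0 uv v0; have [u0|/ltW u0] := leP 0 u.
  by rewrite -(integral_from_to_chasles cf u0 v0) lerDl integral_from_to_ge0.
by rewrite (le_trans (integral_from_to_le0 u0 f0)) // integral_from_to_ge0.
Qed.

(** The Laplace transform of f at 2/x; the parameter x is the reciprocal of the
delta of the Titchmarsh-Kober-Atkinson formula, as in the ladder equation. *)
Definition laplace (R : realType) (f : R -> R) (x : R) : R :=
  \int[lebesgue_measure]_(t in `[0, +oo[) (f t * expR (- (2 * t / x))).

(** The real-valued integral of a nonnegative measurable function that is not
integrable is 0, so a nonzero value is enough to recover integrability. *)
Lemma laplace_integrable (R : realType) (f : R -> R) (x : R) :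
  continuous f -> (forall t, 0 <= f t) -> laplace f x != 0 ->
  lebesgue_measure.-integrable `[0, +oo[
    (EFin \o (fun t : R => f t * expR (- (2 * t / x)))).
Proof.
move=> cf f0 J0; apply/integrableP; split.
  apply/measurable_EFinP; apply: measurable_funTS.
  apply: continuous_measurable_fun => t; apply: cvgM; first exact: cf.
  apply: continuous_comp; last exact: continuous_expR.
  by apply: cvgN; apply: cvgMl; apply: cvgMr; exact: cvg_id.
rewrite (@eq_integral _ _ _ lebesgue_measure _ (fun t : R =>
    (f t * expR (- (2 * t / x)))%:E)); last first.
  by move=> t _ /=; rewrite ger0_norm // mulr_ge0 ?expR_ge0.
by rewrite ltey; apply: contraNneq J0; rewrite /laplace /Rintegral => ->.
Qed.

(** Beyond m, half of the damping is bounded by its value exp(- m / x) at m, and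
the other half is the damping of parameter 2 x. The tail is thus controlled by
the transform itself, without a pointwise bound on f. *)
Lemma laplace_tail (R : realType) (f : R -> R) (x m : R) :
  continuous f -> (forall t, 0 <= f t) -> 0 < x -> 0 <= m ->
  laplace f x != 0 -> laplace f (2 * x) != 0 ->
  0 <= laplace f x -
    \int[lebesgue_measure]_(t in `[0, m]) (f t * expR (- (2 * t / x)))
  <= expR (- (m / x)) * laplace f (2 * x).
Proof.
move=> cf f0 x0 m0 J1 J2.
have i1 := laplace_integrable cf f0 J1; have i2 := laplace_integrable cf f0 J2.
rewrite /laplace Rintegral_itvB //.
have restr (g : R -> R) : lebesgue_measure.-integrable `[0, +oo[ (EFin \o g) ->
    lebesgue_measure.-integrable `]m, +oo[ (EFin \o g).
  by apply: integrableS => //; apply: subset_itvr; rewrite bnd_simp.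
have j1 := restr _ i1; have j2 := restr _ i2.
have z0 y t : 0 <= f t * expR (- (2 * t / y)) by rewrite mulr_ge0 ?expR_ge0.
apply/andP; split; first by apply: Rintegral_ge0 => t _; exact: z0.
apply: (@le_trans _ _ (\int[lebesgue_measure]_(t in `]m, +oo[)
  (expR (- (m / x)) * (f t * expR (- (2 * t / (2 * x))))))).
  apply: le_Rintegral => //.
    rewrite (_ : _ \o _ = fun t : R => ((expR (- (m / x)))%:E *
      (f t * expR (- (2 * t / (2 * x))))%:E)%E) //.
    exact: integrableZl.
  move=> t /=; rewrite in_itv /= andbT => mt.
  rewrite mulrCA ler_wpM2l // -expRD ler_expR.
  rewrite -opprD lerN2 (_ : 2 * t / x = t / x + 2 * t / (2 * x)); last first.
    by field; rewrite gt_eqF.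
  by rewrite lerD2r ler_pM2r ?invr_gt0 // ltW.
rewrite RintegralZl // ler_wpM2l ?expR_ge0 // -(Rintegral_itvB i2) //.
by rewrite gerBl; apply: Rintegral_ge0 => t _; exact: z0.
Qed.

(** * Asymptotics of the ladder equation *)

(** The Titchmarsh-Kober-Atkinson main term at delta = 1/x, 1 / (2 sin delta) being
replaced by x / 2. *)
Definition laplace_main (R : realType) (c0 x : R) : R :=
  x / 2 * (euler_const R - ln (4 * pi) + ln x) + c0.

Lemma laplace_zeta_sq_asymp (R : realType) (zeta : R[i] -> R[i]) (c0 : R) :
  is_TKA_const zeta c0 ->
  laplace (zeta_sq zeta) x - laplace_main c0 x
    @[x --> (+oo : set_system R)] --> (0 : R).
Proof.
move=> /eqO_exP [k k0 /= hk].
have V : x^-1 @[x --> (+oo : set_system R)] --> (0 : R).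
  apply/gtr0_cvgV0; last exact: cvg_id.
  by apply: nbhs_pinfty_gt; rewrite num_real.
have TKA : laplace (zeta_sq zeta) x
    - ((euler_const R - ln (4 * pi) + ln x) / (2 * sin x^-1) + c0)
    @[x --> (+oo : set_system R)] --> (0 : R).
  apply/cvgr0Pnorm_le => e e0; case: hk => d /= d0 hd; near=> x.
  have x0 : 0 < x by near: x; apply: nbhs_pinfty_gt; rewrite num_real.
  have xd : x^-1 < d.
    apply: le_lt_trans (ler_norm _) _.
    by near: x; move/cvgr0Pnorm_lt: V; apply.
  have xe : k * x^-1 <= e.
    rewrite mulrC -ler_pdivlMr //; apply: le_trans (ler_norm _) _.
    by near: x; move/cvgr0Pnorm_le: V; apply; exact: divr_gt0.
  have xi0 : 0 < x^-1 by rewrite invr_gt0.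
  have := hd x^-1; rewrite /= sub0r normrN gtr0_norm // => /(_ xd xi0) h.
  have JE : \int[lebesgue_measure]_(t in `[0, +oo[)
      (zeta_sq zeta t * expR (- (2 * x^-1 * t))) = laplace (zeta_sq zeta) x.
    by apply: eq_Rintegral => t _; rewrite (mulrAC 2).
  have lnE : ln (4 * pi * x^-1) = ln (4 * pi) - ln x :> R.
    by rewrite (@lnM _ (4 * pi)) ?posrE ?mulr_gt0 ?pi_gt0 // lnV ?posrE.
  move: h; rewrite JE lnE opprB addrA [_ + ln x]addrAC => h.
  exact: le_trans h xe.
rewrite -[X in _ --> X]addr0.
rewrite (_ : (fun x => _) = (fun x => laplace (zeta_sq zeta) x -
    ((euler_const R - ln (4 * pi) + ln x) / (2 * sin x^-1) + c0) +
    ((euler_const R - ln (4 * pi) + ln x) / (2 * sin x^-1) -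
     x / 2 * (euler_const R - ln (4 * pi) + ln x)))); last first.
  by apply/funext => x; rewrite /laplace_main; ring.
exact: cvgD TKA (inv_sin_main_term (euler_const R - ln (4 * pi))).
Unshelve. all: by end_near. Qed.

(** The lower bound makes the transform nonzero, hence the integrand integrable,
and the moment unbounded; the square is a crude bound on x ln x. *)
Lemma laplace_main_bounds (R : realType) (c0 : R) :
  \forall x \near (+oo : set_system R),
    x / 4 <= laplace_main c0 x - 1 /\ laplace_main c0 x + 1 <= x ^+ 2.
Proof.
rewrite /laplace_main; set K := euler_const R - _.
near=> x.
have x1 : 1 <= x by near: x; apply: nbhs_pinfty_ge; rewrite num_real.
have xc : 4 * (1 + `|c0|) <= x by near: x; apply: nbhs_pinfty_ge; rewrite num_real.
have xK : `|K| + 1 <= x by near: x; apply: nbhs_pinfty_ge; rewrite num_real.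
have xe : expR (1 - K) <= x by near: x; apply: nbhs_pinfty_ge; rewrite num_real.
have l1 : 1 - K <= ln x by rewrite -ler_expR lnK // posrE; lra.
have l2 : ln x <= x by apply/ltW/ln_sublinear; lra.
have := ler_norm c0; have := ler_norm (- c0); rewrite normrN => c1 c2.
have := ler_norm K => K1.
split.
  have h : x / 2 * 1 <= x / 2 * (K + ln x) by apply: ler_wpM2l; lra.
  lra.
have h : x / 2 * (K + ln x) <= x / 2 * (2 * x - 1) by apply: ler_wpM2l; lra.
nra.
Unshelve. all: by end_near. Qed.

Lemma laplace_zeta_sq_bounds (R : realType) (zeta : R[i] -> R[i]) (c0 : R) :
  is_TKA_const zeta c0 ->
  \forall x \near (+oo : set_system R),
    x / 4 <= laplace (zeta_sq zeta) x <= x ^+ 2.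
Proof.
move=> /laplace_zeta_sq_asymp h; near=> x.
have [b1 b2] : x / 4 <= laplace_main c0 x - 1 /\ laplace_main c0 x + 1 <= x ^+ 2.
  by near: x; exact: laplace_main_bounds.
have : `|laplace (zeta_sq zeta) x - laplace_main c0 x| <= 1.
  by near: x; move/cvgr0Pnorm_le: h; apply.
by rewrite ler_norml; lra.
Unshelve. all: by end_near. Qed.

Lemma truncated_laplace_asymp (R : realType) (zeta : R[i] -> R[i])
    (c0 y0 : R) (mu : R -> R) :
  is_riemann_zeta zeta -> is_TKA_const zeta c0 -> ladder_weight y0 mu ->
  integral_from_to 0 (mu x)
      (fun t => zeta_sq zeta t * expR (- (2 * t / x))) - laplace_main c0 x
    @[x --> (+oo : set_system R)] --> (0 : R).
Proof.
move=> hz hc hmu.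
pose I x : R := integral_from_to 0 (mu x)
  (fun t => zeta_sq zeta t * expR (- (2 * t / x))).
have J_I : laplace (zeta_sq zeta) x - I x
    @[x --> (+oo : set_system R)] --> (0 : R).
  have [M [_ HM]] := laplace_zeta_sq_bounds hc.
  apply/cvgr0Pnorm_le => e e0; near=> x.
  have x1 : 1 <= x by near: x; apply: nbhs_pinfty_ge; rewrite num_real.
  have xy0 : y0 <= x by near: x; apply: nbhs_pinfty_ge; rewrite num_real.
  have xM : `|M| < x by near: x; apply: nbhs_pinfty_gt; rewrite num_real.
  have xe : 4 / e <= x by near: x; apply: nbhs_pinfty_ge; rewrite num_real.
  have Mx := le_lt_trans (ler_norm M) xM.
  have /HM/andP[b1 _] := Mx.
  have /HM/andP[b2 b3] : M < 2 * x by lra.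
  have mux := ladder_weight_ge hmu xy0.
  have l0 : 0 <= ln x by rewrite ln_ge0.
  have m0 : 0 <= mu x by apply: le_trans mux; rewrite !mulr_ge0 //; lra.
  have x0 : 0 < x by exact: lt_le_trans x1.
  have J1 : laplace (zeta_sq zeta) x != 0.
    by apply/lt0r_neq0/(lt_le_trans _ b1); rewrite divr_gt0.
  have J2 : laplace (zeta_sq zeta) (2 * x) != 0.
    by apply/lt0r_neq0/(lt_le_trans _ b2); rewrite divr_gt0 // mulr_gt0.
  have := laplace_tail (continuous_zeta_sq hz) (zeta_sq_ge0 zeta) x0 m0 J1 J2.
  rewrite /I /integral_from_to m0 => /andP[t0 t1].
  rewrite ger0_norm //; apply: (le_trans t1).
  (* The weight bound gives x ^- 7, but any power beyond 2 beats J (2 x). *)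
  have em : expR (- (mu x / x)) <= x ^- 3.
    rewrite -[leRHS]lnK ?posrE ?invr_gt0 ?exprn_gt0 // ler_expR.
    rewrite lnV ?posrE ?exprn_gt0 // lerN2 lnXn // ler_pdivlMr //.
    apply: le_trans mux; rewrite (_ : ln x *+ 3 * x = 3 * x * ln x); last by ring.
    by rewrite ler_wpM2r // ler_wpM2r ?ler_nat // ltW.
  apply: (@le_trans _ _ (x ^- 3 * (2 * x) ^+ 2)).
    apply: ler_pM em b3; first exact: expR_ge0.
    by apply: le_trans b2; rewrite divr_ge0 // mulr_ge0 // ltW.
  have -> : x ^- 3 * (2 * x) ^+ 2 = 4 / x by field; rewrite gt_eqF.
  by rewrite ler_pdivrMr // mulrC -ler_pdivrMr.
rewrite (_ : (fun x => _) = (fun x =>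
    (laplace (zeta_sq zeta) x - laplace_main c0 x)
    - (laplace (zeta_sq zeta) x - I x))); last first.
  by apply/funext => x; rewrite -/(I x); lra.
by rewrite -[X in _ --> X]subr0; apply: cvgB J_I; exact: laplace_zeta_sq_asymp.
Unshelve. all: by end_near. Qed.

(** The ladder is phi / 2, so that phi (psi U) = 2 U for U large: the moment (the
integral of zeta_sq from 0) up to psi U is the truncated transform at 2 U. *)
Lemma moment_at_inverse_asymp (R : realType) (zeta : R[i] -> R[i])
    (c0 y0 T0 : R) (mu phi psi : R -> R) :
  is_riemann_zeta zeta -> is_TKA_const zeta c0 -> ladder_weight y0 mu ->
  is_ladder_solution zeta y0 mu T0 phi ->
  is_ladder_inverse T0 (jacob_ladder phi) psi ->
  integral_from_to 0 (psi U) (zeta_sq zeta) - laplace_main c0 (2 * U)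
    @[U --> +oo] --> 0.
Proof.
move=> hzeta hc0 hmu hphi hinv.
have two : 2 * U @[U --> (+oo : set_system R)] --> (+oo : set_system R).
  apply/cvgryPge => A; near=> U.
  by rewrite mulrC -ler_pdivrMr //; near: U; apply: nbhs_pinfty_ge; rewrite num_real.
have h := cvg_comp _ _ two (truncated_laplace_asymp hzeta hc0 hmu).
apply: cvg_trans h; apply: near_eq_cvg; near=> U => /=.
have [TU phiU] : T0 <= psi U /\ jacob_ladder phi (psi U) = U by near: U.
have phiE : phi (psi U) = 2 * U by rewrite -{2}phiU /jacob_ladder; lra.
by have [_] := hphi _ TU; rewrite phiE => ->.
Unshelve. all: by end_near. Qed.

(** The moment up to psi U tends to infinity by the previous lemma. If psi U
stayed below A, it would be at most the moment up to max(A, 0), because the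
integrand is nonnegative. *)
Lemma cvg_ladder_inverse (R : realType) (zeta : R[i] -> R[i])
    (c0 y0 T0 : R) (mu phi psi : R -> R) :
  is_riemann_zeta zeta -> is_TKA_const zeta c0 -> ladder_weight y0 mu ->
  is_ladder_solution zeta y0 mu T0 phi ->
  is_ladder_inverse T0 (jacob_ladder phi) psi ->
  psi U @[U --> +oo] --> +oo.
Proof.
move=> hzeta hc0 hmu hphi hinv.
have [M [_ HM]] := laplace_main_bounds c0.
apply/cvgryPge => A; near=> U.
have UM : `|M| < U by near: U; apply: nbhs_pinfty_gt; rewrite num_real.
have UI : 2 * integral_from_to 0 (Num.max A 0) (zeta_sq zeta) < U.
  by near: U; apply: nbhs_pinfty_gt; rewrite num_real.
have [b _] : 2 * U / 4 <= laplace_main c0 (2 * U) - 1 /\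
    laplace_main c0 (2 * U) + 1 <= (2 * U) ^+ 2.
  by apply: HM; have := ler_norm M; have := normr_ge0 M; lra.
have : `|integral_from_to 0 (psi U) (zeta_sq zeta) - laplace_main c0 (2 * U)| <= 1.
  near: U; have := moment_at_inverse_asymp hzeta hc0 hmu hphi hinv.
  by move/cvgr0Pnorm_le; apply.
rewrite ler_norml => /andP[d _].
rewrite leNgt; apply/negP => psiA.
have A0 : 0 <= Num.max A 0 by rewrite le_max lexx orbT.
have UA : psi U <= Num.max A 0 by rewrite le_max ltW.
have := le_integral_from_to0 (continuous_zeta_sq hzeta) (zeta_sq_ge0 zeta) UA A0.
lra.
Unshelve. all: by end_near. Qed.

Lemma cvg_reverse_iterate (R : realType) (zeta : R[i] -> R[i])
    (c0 y0 T0 : R) (mu phi psi : R -> R) (r : nat) :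
  is_riemann_zeta zeta -> is_TKA_const zeta c0 -> ladder_weight y0 mu ->
  is_ladder_solution zeta y0 mu T0 phi ->
  is_ladder_inverse T0 (jacob_ladder phi) psi ->
  reverse_iterate psi r T @[T --> +oo] --> +oo.
Proof.
move=> hzeta hc0 hmu hphi hinv.
elim: r => [|r IH]; first exact: cvg_id.
exact: cvg_comp IH (cvg_ladder_inverse hzeta hc0 hmu hphi hinv).
Qed.

(** * The limit *)

(** Both sets carry the same function ln t - zeta_sq t, up to the sign in front of
the second integral, and they partition ]0, U]. *)
Lemma integral_set_plus_minus (R : realType) (zeta : R[i] -> R[i]) (U : R) :
  is_riemann_zeta zeta -> 1 <= U ->
  \int[lebesgue_measure]_(t in set_plus zeta U) (ln t - zeta_sq zeta t)
  - \int[lebesgue_measure]_(t in set_minus zeta U) (- ln t + zeta_sq zeta t)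
  = U * ln U - U - integral_from_to 0 U (zeta_sq zeta).
Proof.
move=> hz U1; pose g t : R := ln t - zeta_sq zeta t.
have [il Il] := Rintegral_ln U1.
have iz : lebesgue_measure.-integrable `]0, U] (EFin \o zeta_sq zeta).
  have := @continuous_itv_integrable _ _ 0 U (continuous_zeta_sq hz).
  apply: integrableS => //.
  by apply: subset_itvr; rewrite bnd_simp.
have ig : lebesgue_measure.-integrable `]0, U] (EFin \o g).
  rewrite (_ : EFin \o g = (EFin \o @ln R) \- (EFin \o zeta_sq zeta))%E //.
  exact: integrableB.
have mg : measurable_fun setT g.
  apply: measurable_funB; first exact: measurable_ln.
  by apply: continuous_measurable_fun; exact: continuous_zeta_sq.
have pE : set_plus zeta U = `]0, U] `&` (setT `&` g @^-1` `]0, +oo[).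
  apply/seteqP; split => t /=; rewrite /set_plus /g /= !in_itv /= andbT subr_gt0.
    by move=> [].
  by move=> [? []].
have mE : set_minus zeta U = `]0, U] `&` (setT `&` g @^-1` `]-oo, 0]).
  apply/seteqP; split => t /=; rewrite /set_minus /g /= !in_itv /= subr_le0.
    by move=> [].
  by move=> [? []].
have mp : measurable (set_plus zeta U).
  by rewrite pE; apply: measurableI => //; apply: mg.
have mm : measurable (set_minus zeta U).
  by rewrite mE; apply: measurableI => //; apply: mg.
have UE : `]0, U]%classic = set_plus zeta U `|` set_minus zeta U.
  apply/seteqP; split => t /=; rewrite /set_plus /set_minus in_itv /=.
    by move=> tU; have [zt|zt] := ltP (zeta_sq zeta t) (ln t); [left|right].
  by case=> [[]|[]].
have dj : [disjoint set_plus zeta U & set_minus zeta U].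
  by apply/disj_setPS => t [[_ lt1] [_]]; rewrite leNgt lt1.
have im : lebesgue_measure.-integrable (set_minus zeta U) (EFin \o g).
  by move: ig; apply: integrableS => //; rewrite UE; exact: subsetUr.
have -> : \int[lebesgue_measure]_(t in set_minus zeta U)
    (- ln t + zeta_sq zeta t) = - \int[lebesgue_measure]_(t in set_minus zeta U) g t.
  rewrite -mulN1r -RintegralZl //; apply: eq_Rintegral => t _.
  by rewrite /g mulN1r opprB addrC.
rewrite opprK -Rintegral_setU //; last by rewrite -UE.
rewrite -UE RintegralB // Il [X in _ - X]Rintegral_itv_obnd_cbnd //.
by rewrite /integral_from_to ifT //; lra.
Qed.

(** The case r = 1, as a statement on U alone: the difference of the set integrals,
less the integral from U to psi U, is U ln U - U minus the moment up to psi U,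
whose asymptotics are known. *)
Lemma first_reverse_iterate_limit (R : realType) (zeta : R[i] -> R[i])
    (c0 y0 T0 : R) (mu phi psi : R -> R) :
  is_riemann_zeta zeta -> is_TKA_const zeta c0 -> ladder_weight y0 mu ->
  is_ladder_solution zeta y0 mu T0 phi ->
  is_ladder_inverse T0 (jacob_ladder phi) psi ->
  \int[lebesgue_measure]_(t in set_plus zeta U) (ln t - zeta_sq zeta t)
  - \int[lebesgue_measure]_(t in set_minus zeta U) (- ln t + zeta_sq zeta t)
  - integral_from_to U (psi U) (zeta_sq zeta)
  - (ln (2 * pi) - 1 - euler_const R) * U @[U --> +oo] --> - c0.
Proof.
move=> hzeta hc0 hmu hphi hinv.
have h : - c0 - (integral_from_to 0 (psi U) (zeta_sq zeta) -
    laplace_main c0 (2 * U)) @[U --> +oo] --> - c0.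
  by rewrite -[X in _ --> X]subr0; apply: cvgB (cvg_cst _) _;
    exact: moment_at_inverse_asymp hmu hphi hinv.
apply: cvg_trans h; apply: near_eq_cvg; near=> U.
have U1 : 1 <= U by near: U; apply: nbhs_pinfty_ge; rewrite num_real.
have U0 : 0 < U by lra.
have V0 : 0 <= psi U.
  near: U; have := cvg_ladder_inverse hzeta hc0 hmu hphi hinv.
  by move/cvgryPge; apply.
rewrite integral_set_plus_minus //=.
rewrite -(integral_from_to_chasles (continuous_zeta_sq hzeta) (ltW U0) V0).
rewrite /laplace_main (_ : 4 * pi = 2 * (2 * pi)); last by ring.
rewrite !(@lnM _ 2) ?posrE ?mulr_gt0 ?pi_gt0 //.
field.
Unshelve. all: by end_near. Qed.

Theorem theorem2 (R : realType) (zeta : R[i] -> R[i])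
    (hzeta : is_riemann_zeta zeta)
    (c0 : R) (hc0 : is_TKA_const zeta c0)
    (y0 : R) (mu : R -> R) (hmu : ladder_weight y0 mu)
    (T0 : R) (phi : R -> R) (hphi : is_ladder_solution zeta y0 mu T0 phi)
    (phi1_inv : R -> R)
    (hinv : is_ladder_inverse T0 (jacob_ladder phi) phi1_inv)
    (k r : nat) (hr : (1 <= r <= k)%N) :
  (fun T : R =>
     let U := reverse_iterate phi1_inv r.-1 T in
     let V := reverse_iterate phi1_inv r T in
     \int[lebesgue_measure]_(t in set_plus zeta U) (ln t - zeta_sq zeta t)
     - \int[lebesgue_measure]_(t in set_minus zeta U) (- ln t + zeta_sq zeta t)
     - integral_from_to U V (zeta_sq zeta)
     - (ln (2 * pi) - 1 - euler_const R) * U) @ +oo --> - c0.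
Proof.
(* Substitute U, the (r - 1)-th iterate at T, in the case r = 1. *)
case: r hr => // r _; rewrite succnK.
exact: cvg_comp (cvg_reverse_iterate r hzeta hc0 hmu hphi hinv)
                (first_reverse_iterate_limit hzeta hc0 hmu hphi hinv).
Qed.
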